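(* Let $u(x)$ be a smooth real function on an open interval $I$ and let $z\in\mathbb{R}$ be a constant. Then the Schrödinger equation $$\frac{d^2y}{dx^2}-u(x)\,y=z\,y,\qquad y=y(x),$$ is metrisable, and the coefficients of the metric $ds^2=g_{11}(x,y)\,dx^2+2g_{12}(x,y)\,dx\,dy+g_{22}(x,y)\,dy^2$ have the following form. Let $r_0\in\mathbb{R}$ be a constant and let $s(x),l(x)$ be real functions on $I$ satisfying $$s''(x)-u(x)s(x)=z\,s(x),\qquad l'''(x)-4(u(x)+z)\,l'(x)-2u'(x)\,l(x)=0,$$ such that the function $$D(x,y)=\Big(s(x)-\tfrac12 y\,l'(x)\Big)^2-l(x)\Big(r_0+\tfrac12 y\big(y\,l''(x)-4s'(x)-2y\,l(x)(u(x)+z)\big)\Big)$$ is not identically zero. Put $\lambda(x,y)=D(x,y)^{-2}$ and $$g_{11}(x,y)=\lambda(x,y)\Big(r_0+\tfrac12 y\big(y\,l''(x)-4s'(x)-2y\,l(x)(u(x)+z)\big)\Big),$$ $$g_{12}(x,y)=\lambda(x,y)\Big(s(x)-\tfrac12 y\,l'(x)\Big),\qquad g_{22}(x,y)=\lambda(x,y)\,l(x).$$ Then on the open set $\{(x,y)\in I\times\mathbb{R}: D(x,y)\neq 0\}$ these formulas define a (Riemannian or pseudo-Riemannian) metric $ds^2$ which metrises the Schrödinger equation above. Moreover, the Gaussian curvature $K$ of $ds^2$ is given by $$4K=2\,(r_0l-s^2)\,l''-r_0\,(l')^2+4\,s\,l'\,s'-4\,l\,(s')^2+4\,l\,(s^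2-r_0l)\,(u+z).$$
   Context: For a Riemannian or pseudo-Riemannian metric $ds^2=g_{11}dx^2+2g_{12}dx\,dy+g_{22}dy^2$ on a 2-surface with local coordinates $u^1=x$, $u^2=y$ and Christoffel symbols $\Gamma^k_{ij}$, the geodesics regarded as unparametrized curves $y=y(x)$ satisfy $$\frac{d^2y}{dx^2}=A_3(x,y)\Big(\frac{dy}{dx}\Big)^3+A_2(x,y)\Big(\frac{dy}{dx}\Big)^2+A_1(x,y)\frac{dy}{dx}+A_0(x,y)\qquad( * )$$ with $$A_3=\Gamma^1_{22},\quad A_2=2\Gamma^1_{12}-\Gamma^2_{22},\quad A_1=\Gamma^1_{11}-2\Gamma^2_{12},\quad A_0=-\Gamma^2_{11}.\qquad( ** )$$ An equation of the form $( * )$ with given coefficients $A_0,\dots,A_3$ is called metrisable if there exists a Riemannian or pseudo-Riemannian metric (on an open set of the $(x,y)$-plane) whose Christoffel symbols satisfy $( ** )$, i.e. a metric whose geodesics satisfy $( * )$; such a metric is said to metrise the equation. The Schrödinger equation $y''=(u(x)+z)y$ is the equation $( * )$ with $A_0=(u(x)+z)y$ and $A_1=A_2=A_3=0$. For a possibly indefinite metric, the Gaussian curvature is $K=R_{1212}/(g_{11}g_{22}-g_{12}^2)$, with the sign convention that the round unit sphere has $K=1$. Primes denote derivatives with respect to $x$. *)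

(* Defs.v *)
From Stdlib Require Import Reals.
From Coquelicot Require Import Coquelicot.
Open Scope R_scope.

Definition interval_oo (a b : Rbar) (x : R) : Prop :=
  Rbar_lt a x /\ Rbar_lt x b.

(* All orders up to n are required: Coquelicot's [Derive] is total, so
   [ex_derive_n f n x] alone says nothing about the lower derivatives of f. *)
Definition n_times_derivable (n : nat) (I : R -> Prop) (f : R -> R) : Prop :=
  forall (k : nat) (x : R), (k <= n)%nat -> I x -> ex_derive_n f k x.

Definition smooth1 (I : R -> Prop) (f : R -> R) : Prop :=
  forall n : nat, n_times_derivable n I f.

(* [ex_diff_n f n x y] : all iterated partial derivatives of f of total order
   at most n exist and are continuous at (x, y). *)
Definition smooth2 (U : R * R -> Prop) (f : R -> R -> R) : Prop :=
  forall (n : nat) (x y : R), U (x, y) -> ex_diff_n f n x y.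

(* Tensor indices: i1 is the coordinate u^1 = x and i2 is u^2 = y. *)
Inductive idx : Set := i1 | i2.

Definition sum_idx (f : idx -> R) : R := f i1 + f i2.

Definition pd (i : idx) (f : R -> R -> R) (x y : R) : R :=
  match i with
  | i1 => Derive (fun t => f t y) x
  | i2 => Derive (fun t => f x t) y
  end.

Record metric_coeffs : Type :=
  MetricCoeffs { g11 : R -> R -> R; g12 : R -> R -> R; g22 : R -> R -> R }.

Definition g_low (g : metric_coeffs) (i j : idx) : R -> R -> R :=
  match i, j with
  | i1, i1 => g11 g
  | i2, i2 => g22 g
  | _, _ => g12 g
  end.

Definition g_det (g : metric_coeffs) (x y : R) : R :=
  g11 g x y * g22 g x y - g12 g x y ^ 2.

Definition g_up (g : metric_coeffs) (i j : idx) (x y : R) : R :=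
  match i, j with
  | i1, i1 => g22 g x y / g_det g x y
  | i2, i2 => g11 g x y / g_det g x y
  | _, _ => - g12 g x y / g_det g x y
  end.

(* Nondegeneracy is the only condition on the signature, so definite
   (Riemannian up to sign) and Lorentzian metrics are both covered. *)
Definition is_metric_on (U : R * R -> Prop) (g : metric_coeffs) : Prop :=
  open U /\
  (forall i j : idx, smooth2 U (g_low g i j)) /\
  (forall x y : R, U (x, y) -> g_det g x y <> 0).

(* Gamma^k_{ij} *)
Definition christoffel (g : metric_coeffs) (k i j : idx) (x y : R) : R :=
  / 2 * sum_idx (fun m =>
    g_up g k m x y *
    (pd i (g_low g m j) x y + pd j (g_low g m i) x y - pd m (g_low g i j) x y)).

(* R^m_{kij}: the component along the m-th coordinate field of
   (nabla_i nabla_j - nabla_j nabla_i) applied to the k-th coordinate field;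
   with this convention the unit sphere has K = 1 below. *)
Definition riemann_up (g : metric_coeffs) (m k i j : idx) (x y : R) : R :=
  pd i (christoffel g m j k) x y - pd j (christoffel g m i k) x y +
  sum_idx (fun p =>
    christoffel g m i p x y * christoffel g p j k x y -
    christoffel g m j p x y * christoffel g p i k x y).

Definition riemann_low (g : metric_coeffs) (l k i j : idx) (x y : R) : R :=
  sum_idx (fun m => g_low g l m x y * riemann_up g m k i j x y).

Definition gauss_curvature (g : metric_coeffs) (x y : R) : R :=
  riemann_low g i1 i2 i1 i2 x y / g_det g x y.

(* The equation y'' = A3 (y')^3 + A2 (y')^2 + A1 y' + A0. *)
Record cubic_ode : Type :=
  CubicOde { A0 : R -> R -> R; A1 : R -> R -> R;
             A2 : R -> R -> R; A3 : R -> R -> R }.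

Definition metrises (U : R * R -> Prop) (g : metric_coeffs) (E : cubic_ode)
    : Prop :=
  is_metric_on U g /\
  forall x y : R, U (x, y) ->
    A3 E x y = christoffel g i1 i2 i2 x y /\
    A2 E x y = 2 * christoffel g i1 i1 i2 x y - christoffel g i2 i2 i2 x y /\
    A1 E x y = christoffel g i1 i1 i1 x y - 2 * christoffel g i2 i1 i2 x y /\
    A0 E x y = - christoffel g i2 i1 i1 x y.

(* W is the domain of the coefficients of E. *)
Definition metrisable (W : R * R -> Prop) (E : cubic_ode) : Prop :=
  exists (U : R * R -> Prop) (g : metric_coeffs),
    (exists p, U p) /\ (forall p, U p -> W p) /\ metrises U g E.

Definition schrodinger (u : R -> R) (z : R) : cubic_ode :=
  CubicOde (fun x y => (u x + z) * y) (fun _ _ => 0)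
           (fun _ _ => 0) (fun _ _ => 0).

Definition E_coef (u : R -> R) (z r0 : R) (s l : R -> R) (x y : R) : R :=
  r0 + / 2 * y *
    (y * Derive_n l 2 x - 4 * Derive s x - 2 * y * l x * (u x + z)).

Definition F_coef (s l : R -> R) (x y : R) : R :=
  s x - / 2 * y * Derive l x.

Definition D_coef (u : R -> R) (z r0 : R) (s l : R -> R) (x y : R) : R :=
  F_coef s l x y ^ 2 - l x * E_coef u z r0 s l x y.

Definition lambda_coef (u : R -> R) (z r0 : R) (s l : R -> R) (x y : R) : R :=
  / (D_coef u z r0 s l x y ^ 2).

Definition schrodinger_metric (u : R -> R) (z r0 : R) (s l : R -> R)
    : metric_coeffs :=
  MetricCoeffs
    (fun x y => lambda_coef u z r0 s l x y * E_coef u z r0 s l x y)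
    (fun x y => lambda_coef u z r0 s l x y * F_coef s l x y)
    (fun x y => lambda_coef u z r0 s l x y * l x).

(* Main.v *)
Require Import Defs.
From Stdlib Require Import ssreflect Reals Lra Lia.
From Coquelicot Require Import Coquelicot.
Open Scope R_scope.

(** Write q = u + z, let E, F be the quadratic, resp. affine, functions of y
    in the statement, and let sigma be the symmetric matrix with entries
    sigma_11 = E, sigma_12 = F, sigma_22 = l, so that D = - det sigma and
    g = sigma / D^2.  Hence det g = - 1 / D^3, and sigma = |det g|^(-2/3) g is
    Liouville's rescaling, for which the condition that g metrises
    y'' = q y becomes linear:
      E_x = - 2 q y F,   E_y + 2 F_x = - 2 q y l,
      2 F_y + l_x = 0,   l_y = 0.
    The functions E, F, l of the statement solve this system exactly because
    of the equations imposed on s and l.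

    Substituting the system into the Christoffel symbols ([christoffelE])
    shows that they are the connection with the single coefficient
    Gamma^2_11 = - q y, plus a pure projective change delta^k_i psi_j +
    delta^k_j psi_i with psi_j = - D_j / (2 D); such a change leaves the
    unparametrised geodesics alone.  The form of psi is forced by the trace
    Gamma^i_ij = (1/2) (log |det g|)_j = - (3/2) D_j / D.
    The same closed form of the symbols holds on a whole neighbourhood, so it
    may be differentiated, and the curvature is then a rational function of
    y, r0, q and the derivatives of s and l in which y and D cancel
    ([gauss_curvature_schrodinger]).

    A metric has to be smooth whereas s and l are only assumed to be a few
    times differentiable; their equations express the highest derivatives
    through lower ones, so regularity propagates ([jet_equations_C_on]).

    For metrisability take l = 0 and r0 = 0: then D = s^2, and it suffices to
    find one solution s of s'' = q s with s <> 0 near one point.  It is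
    obtained by Picard iteration ([linear_ode_local]). *)

(** * Functions of two variables of class C^n on an open set *)

Definition C_on (n : nat) (U : R * R -> Prop) (f : R -> R -> R) : Prop :=
  forall x y : R, U (x, y) -> ex_diff_n f n x y.

Lemma open_locally_2d (U : R * R -> Prop) (x y : R) :
  open U -> U (x, y) -> locally_2d (fun v w => U (v, w)) x y.
Proof.
intros oU Uxy; apply locally_2d_locally.
apply: filter_imp (oU _ Uxy); now intros [v w].
Qed.

Lemma C_on_ext (n : nat) (U : R * R -> Prop) (f g : R -> R -> R) :
  open U -> (forall x y, U (x, y) -> f x y = g x y) -> C_on n U f -> C_on n U g.
Proof.
intros oU fg Cf x y Uxy; apply (ex_diff_n_ext_loc f); [|now apply Cf].
apply: locally_2d_impl (open_locally_2d _ _ _ oU Uxy).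
now apply locally_2d_forall; intros v w; apply fg.
Qed.

Lemma C_on_le (m n : nat) (U : R * R -> Prop) (f : R -> R -> R) :
  (m <= n)%nat -> C_on n U f -> C_on m U f.
Proof. now intros mn Cf x y Uxy; apply (ex_diff_n_m n); [|apply Cf]. Qed.

Lemma C_on_continuity (n : nat) (U : R * R -> Prop) (f : R -> R -> R) (x y : R) :
  C_on n U f -> U (x, y) -> continuity_2d_pt f x y.
Proof. intros Cf Uxy; specialize (Cf x y Uxy); destruct n; apply Cf. Qed.

(** The derivatives are given by formulas, so that an induction on n proves
    closure of C^n under an operation from the differentiation rule for it.
    Continuity of f is a separate premise: existence of both partial
    derivatives does not imply it. *)
Lemma C_on_S (n : nat) (U : R * R -> Prop) (f f1 f2 : R -> R -> R) :
  open U -> C_on 0 U f ->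
  (forall x y, U (x, y) -> is_derive (fun t => f t y) x (f1 x y)) ->
  (forall x y, U (x, y) -> is_derive (fun t => f x t) y (f2 x y)) ->
  C_on n U f1 -> C_on n U f2 -> C_on (S n) U f.
Proof.
intros oU C0 d1 d2 C1 C2 x y Uxy; split; [now apply (C_on_continuity 0 U)|].
split; [now exists (f1 x y); apply d1|].
split; [now exists (f2 x y); apply d2|].
split.
- apply (C_on_ext n U f1); trivial.
  now intros v w Uvw; symmetry; apply is_derive_unique, d1.
- apply (C_on_ext n U f2); trivial.
  now intros v w Uvw; symmetry; apply is_derive_unique, d2.
Qed.

Lemma C_on_is_derive (n : nat) (i : idx) (U : R * R -> Prop) (f : R -> R -> R) (x y : R) :
  C_on (S n) U f -> U (x, y) ->
  match i with
  | i1 => is_derive (fun t => f t y) x (pd i1 f x y)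
  | i2 => is_derive (fun t => f x t) y (pd i2 f x y)
  end.
Proof.
intros Cf Uxy; destruct (Cf x y Uxy) as (_ & d1 & d2 & _).
now destruct i; apply Derive_correct.
Qed.

Lemma C_on_pd (n : nat) (i : idx) (U : R * R -> Prop) (f : R -> R -> R) :
  C_on (S n) U f -> C_on n U (pd i f).
Proof.
intros Cf x y Uxy; destruct (Cf x y Uxy) as (_ & _ & _ & C1 & C2).
now destruct i.
Qed.

Lemma C_on_const (n : nat) (U : R * R -> Prop) (c : R) :
  open U -> C_on n U (fun _ _ => c).
Proof.
intros oU; revert c; induction n as [|n IH]; intros c.
- intros x y _; split; [apply continuity_2d_pt_const | trivial].
- apply C_on_S with (fun _ _ => 0) (fun _ _ => 0); try apply IH; trivial.
  + intros x y _; split; [apply continuity_2d_pt_const | trivial].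
  + intros x y _; apply @is_derive_const.
  + intros x y _; apply @is_derive_const.
Qed.

Lemma C_on_snd (n : nat) (U : R * R -> Prop) : open U -> C_on n U (fun _ y => y).
Proof.
intros oU.
assert (C0 : C_on 0 U (fun _ y => y)).
{ intros x y _; split; [apply continuity_2d_pt_id2 | trivial]. }
destruct n as [|n]; [exact C0|].
apply C_on_S with (fun _ _ => 0) (fun _ _ => 1); try (now apply C_on_const); trivial.
- intros x y _; apply @is_derive_const.
- intros x y _; apply @is_derive_id.
Qed.

Lemma C_on_plus (n : nat) (U : R * R -> Prop) (f g : R -> R -> R) :
  open U -> C_on n U f -> C_on n U g -> C_on n U (fun x y => f x y + g x y).
Proof.
intros oU; revert f g; induction n as [|n IH]; intros f g Cf Cg.
- intros x y Uxy; split; trivial.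
  now apply continuity_2d_pt_plus; apply (C_on_continuity 0 U).
- apply C_on_S with (fun x y => pd i1 f x y + pd i1 g x y)
    (fun x y => pd i2 f x y + pd i2 g x y); try (apply IH; now apply C_on_pd); trivial.
  + intros x y Uxy; split; trivial.
    now apply continuity_2d_pt_plus; apply (C_on_continuity (S n) U).
  + intros x y Uxy; apply: is_derive_plus; now apply (C_on_is_derive n i1 U).
  + intros x y Uxy; apply: is_derive_plus; now apply (C_on_is_derive n i2 U).
Qed.

Lemma C_on_mult (n : nat) (U : R * R -> Prop) (f g : R -> R -> R) :
  open U -> C_on n U f -> C_on n U g -> C_on n U (fun x y => f x y * g x y).
Proof.
intros oU; revert f g; induction n as [|n IH]; intros f g Cf Cg.
- intros x y Uxy; split; trivial.
  now apply continuity_2d_pt_mult; apply (C_on_continuity 0 U).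
- assert (Cf' : C_on n U f) by (apply (C_on_le n (S n)); [lia | trivial]).
  assert (Cg' : C_on n U g) by (apply (C_on_le n (S n)); [lia | trivial]).
  apply C_on_S with (fun x y => pd i1 f x y * g x y + f x y * pd i1 g x y)
    (fun x y => pd i2 f x y * g x y + f x y * pd i2 g x y);
    try (apply C_on_plus; trivial; apply IH; trivial; now apply C_on_pd); trivial.
  + intros x y Uxy; split; trivial.
    now apply continuity_2d_pt_mult; apply (C_on_continuity (S n) U).
  + intros x y Uxy; apply (is_derive_mult (fun t => f t y) (fun t => g t y));
      [now apply (C_on_is_derive n i1 U) .. | intros; apply Rmult_comm].
  + intros x y Uxy; apply (is_derive_mult (fun t => f x t) (fun t => g x t));
      [now apply (C_on_is_derive n i2 U) .. | intros; apply Rmult_comm].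
Qed.

Lemma C_on_inv (n : nat) (U : R * R -> Prop) (f : R -> R -> R) :
  open U -> (forall x y, U (x, y) -> f x y <> 0) ->
  C_on n U f -> C_on n U (fun x y => / f x y).
Proof.
intros oU f0; induction n as [|n IH]; intros Cf.
- intros x y Uxy; split; trivial.
  apply continuity_2d_pt_inv; [now apply (C_on_continuity 0 U) | now apply f0].
- assert (Cf' : C_on n U (fun x y => / f x y)).
  { apply IH, (C_on_le n (S n)); [lia | trivial]. }
  assert (C' : forall i, C_on n U
      (fun x y => (-1 * pd i f x y) * (/ f x y * / f x y))).
  { intros i; apply C_on_mult; trivial; apply C_on_mult; trivial.
    - now apply C_on_const.
    - now apply C_on_pd. }
  eapply C_on_S; [trivial | | | | apply (C' i1) | apply (C' i2)].
  + intros x y Uxy; split; trivial.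
    apply continuity_2d_pt_inv; [now apply (C_on_continuity (S n) U) | now apply f0].
  + intros x y Uxy; assert (fxy := f0 x y Uxy); cbv beta.
    replace (-1 * pd i1 f x y * (/ f x y * / f x y))
      with (- pd i1 f x y / f x y ^ 2) by now field.
    now apply (is_derive_inv (fun t => f t y)); [apply (C_on_is_derive n i1 U)|].
  + intros x y Uxy; assert (fxy := f0 x y Uxy); cbv beta.
    replace (-1 * pd i2 f x y * (/ f x y * / f x y))
      with (- pd i2 f x y / f x y ^ 2) by now field.
    now apply (is_derive_inv (fun t => f x t)); [apply (C_on_is_derive n i2 U)|].
Qed.

(** * Functions of x alone, and regularity of s and l *)

Lemma open_cylinder (I : R -> Prop) : open I -> open (fun p : R * R => I (fst p)).
Proof.
intros oI; apply (open_comp (fun p : R * R => fst p) I); trivial.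
intros p _; apply continuous_fst.
Qed.

Lemma C_on_lift_0 (I : R -> Prop) (f f' : R -> R) :
  (forall x, I x -> is_derive f x (f' x)) ->
  C_on 0 (fun p => I (fst p)) (fun x _ => f x).
Proof.
intros df x y Ix; split; trivial.
apply (continuity_1d_2d_pt_comp f (fun v _ => v)).
- apply continuity_pt_filterlim.
  apply: ex_derive_continuous; exists (f' x); now apply df.
- apply continuity_2d_pt_id1.
Qed.

Lemma C_on_lift_S (n : nat) (I : R -> Prop) (f f' : R -> R) :
  open I -> (forall x, I x -> is_derive f x (f' x)) ->
  C_on n (fun p => I (fst p)) (fun x _ => f' x) ->
  C_on (S n) (fun p => I (fst p)) (fun x _ => f x).
Proof.
intros oI df Cf'; assert (oU := open_cylinder I oI).
apply C_on_S with (fun x _ => f' x) (fun _ _ => 0); trivial.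
- now apply C_on_lift_0 with f'.
- intros x y Ix; now apply df.
- intros x y _; apply @is_derive_const.
- now apply C_on_const.
Qed.

Lemma n_times_derivable_is_derive (n k : nat) (I : R -> Prop) (f : R -> R) (x : R) :
  n_times_derivable n I f -> (k < n)%nat -> I x ->
  is_derive (Derive_n f k) x (Derive_n f (S k) x).
Proof. intros df kn Ix; apply Derive_correct, (df (S k)); trivial. Qed.

Lemma smooth1_C_on (I : R -> Prop) (f : R -> R) (n : nat) :
  open I -> smooth1 I f -> C_on n (fun p => I (fst p)) (fun x _ => f x).
Proof.
intros oI sf.
assert (d : forall k x, I x -> is_derive (Derive_n f k) x (Derive_n f (S k) x)).
{ intros k x Ix; apply n_times_derivable_is_derive with (S k) I; trivial; lia. }
assert (H : forall n k, C_on n (fun p => I (fst p)) (fun x _ => Derive_n f k x)).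
{ clear n; intros n; induction n as [|n IH]; intros k.
  - now apply C_on_lift_0 with (Derive_n f (S k)), d.
  - apply C_on_lift_S with (Derive_n f (S k)); trivial; now apply d. }
exact (H n 0%nat).
Qed.

(** The equations for s and l as a first-order system for (s, s') and
    (l, l', l''): the form in which they are differentiated below. *)
Definition jet_equations (I : R -> Prop) (u : R -> R) (z : R) (s l : R -> R) : Prop :=
  forall x, I x ->
    is_derive u x (Derive u x) /\
    is_derive s x (Derive s x) /\
    is_derive (Derive s) x ((u x + z) * s x) /\
    is_derive l x (Derive l x) /\
    is_derive (Derive l) x (Derive_n l 2 x) /\
    is_derive (Derive_n l 2) x (4 * (u x + z) * Derive l x + 2 * Derive u x * l x).

Lemma jet_equations_intro (I : R -> Prop) (u : R -> R) (z : R) (s l : R -> R) :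
  smooth1 I u ->
  n_times_derivable 2 I s -> n_times_derivable 3 I l ->
  (forall x : R, I x -> Derive_n s 2 x - u x * s x = z * s x) ->
  (forall x : R, I x ->
     Derive_n l 3 x - 4 * (u x + z) * Derive l x - 2 * Derive u x * l x = 0) ->
  jet_equations I u z s l.
Proof.
intros su ds dl es el x Ix; specialize (es x Ix); specialize (el x Ix).
refine (conj _ (conj _ (conj _ (conj _ (conj _ _))))).
- apply (n_times_derivable_is_derive 1 0 I u x); auto; lia.
- apply (n_times_derivable_is_derive 2 0 I s x); auto; lia.
- replace ((u x + z) * s x) with (Derive_n s 2 x) by lra.
  apply (n_times_derivable_is_derive 2 1 I s x); auto; lia.
- apply (n_times_derivable_is_derive 3 0 I l x); auto; lia.
- apply (n_times_derivable_is_derive 3 1 I l x); auto; lia.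
- match goal with |- is_derive _ _ ?d => replace d with (Derive_n l 3 x) by lra end.
  apply (n_times_derivable_is_derive 3 2 I l x); auto; lia.
Qed.

(** If all components of the first-order system are C^n, so are the right-hand
    sides, hence the components are C^(n+1).  The induction has to treat
    s, s' (and l, l', l'') together. *)
Lemma jet_equations_C_on (I : R -> Prop) (u : R -> R) (z : R) (s l : R -> R) (n : nat) :
  open I -> smooth1 I u -> jet_equations I u z s l ->
  let U := fun p : R * R => I (fst p) in
  (C_on n U (fun x _ => s x) /\ C_on n U (fun x _ => Derive s x)) /\
  (C_on n U (fun x _ => l x) /\ C_on n U (fun x _ => Derive l x) /\
   C_on n U (fun x _ => Derive_n l 2 x)).
Proof.
intros oI su J U; assert (oU : open U) by now apply open_cylinder.
assert (Cu : forall n, C_on n U (fun x _ => u x)) by (intros; now apply smooth1_C_on).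
assert (Cu' : forall n, C_on n U (fun x _ => Derive u x)).
{ intros k; apply (C_on_pd k i1 U (fun x _ => u x)), Cu. }
assert (Cq : forall n, C_on n U (fun x _ => u x + z)).
{ intros k; apply C_on_plus; trivial; now apply C_on_const. }
induction n as [|n ((Cs & Cs1) & (Cl & Cl1 & Cl2))].
- refine (conj (conj _ _) (conj _ (conj _ _))).
  + now apply (C_on_lift_0 I _ (Derive s)); intros x Ix; destruct (J x Ix).
  + apply (C_on_lift_0 I _ (fun x => (u x + z) * s x)); intros x Ix; apply (J x Ix).
  + apply (C_on_lift_0 I _ (Derive l)); intros x Ix; apply (J x Ix).
  + apply (C_on_lift_0 I _ (Derive_n l 2)); intros x Ix; apply (J x Ix).
  + eapply (C_on_lift_0 I _); intros x Ix; apply (J x Ix).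
- refine (conj (conj _ _) (conj _ (conj _ _))).
  + apply (C_on_lift_S n I _ (Derive s)); trivial; intros x Ix; apply (J x Ix).
  + apply (C_on_lift_S n I _ (fun x => (u x + z) * s x)); trivial.
    * intros x Ix; apply (J x Ix).
    * now apply C_on_mult.
  + apply (C_on_lift_S n I _ (Derive l)); trivial; intros x Ix; apply (J x Ix).
  + apply (C_on_lift_S n I _ (Derive_n l 2)); trivial; intros x Ix; apply (J x Ix).
  + apply (C_on_lift_S n I _
      (fun x => 4 * (u x + z) * Derive l x + 2 * Derive u x * l x)); trivial.
    * intros x Ix; apply (J x Ix).
    * apply C_on_plus; trivial; repeat (apply C_on_mult; trivial); now apply C_on_const.
Qed.

(** * Smoothness of the metric *)

Lemma EFD_C_on (I : R -> Prop) (u : R -> R) (z r0 : R) (s l : R -> R) (n : nat) :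
  open I -> smooth1 I u -> jet_equations I u z s l ->
  let U := fun p : R * R => I (fst p) in
  C_on n U (E_coef u z r0 s l) /\ C_on n U (F_coef s l) /\ C_on n U (D_coef u z r0 s l).
Proof.
intros oI su J U; assert (oU : open U) by now apply open_cylinder.
destruct (jet_equations_C_on I u z s l n oI su J) as ((Cs & Cs1) & (Cl & Cl1 & Cl2)).
assert (Cc := fun c => C_on_const n U c oU).
assert (Cy := C_on_snd n U oU).
assert (Cq : C_on n U (fun x _ => u x + z)).
{ apply C_on_plus; trivial; now apply smooth1_C_on. }
assert (CE : C_on n U (E_coef u z r0 s l)).
{ apply C_on_ext with (fun x y => r0 + / 2 * y * (y * Derive_n l 2 x
    + -4 * Derive s x + -2 * y * l x * (u x + z))); trivial.
  - intros; unfold E_coef; ring.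
  - repeat first [apply C_on_plus; trivial | apply C_on_mult; trivial]. }
assert (CF : C_on n U (F_coef s l)).
{ apply C_on_ext with (fun x y => s x + - / 2 * y * Derive l x); trivial.
  - intros; unfold F_coef; ring.
  - repeat first [apply C_on_plus; trivial | apply C_on_mult; trivial]. }
refine (conj CE (conj CF _)).
apply C_on_ext with (fun x y => F_coef s l x y * F_coef s l x y +
  -1 * (l x * E_coef u z r0 s l x y)); trivial.
- intros; unfold D_coef; ring.
- repeat first [apply C_on_plus; trivial | apply C_on_mult; trivial].
Qed.

Definition nondegenerate (I : R -> Prop) (u : R -> R) (z r0 : R) (s l : R -> R)
    (p : R * R) : Prop :=
  I (fst p) /\ D_coef u z r0 s l (fst p) (snd p) <> 0.

Lemma nondegenerate_open (I : R -> Prop) (u : R -> R) (z r0 : R) (s l : R -> R) :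
  open I -> smooth1 I u -> jet_equations I u z s l -> open (nondegenerate I u z r0 s l).
Proof.
intros oI su J [x y] [Ix Dxy].
destruct (EFD_C_on I u z r0 s l 0 oI su J) as (_ & _ & CD).
apply filter_and; [exact (open_cylinder I oI (x, y) Ix)|].
apply (locally_2d_locally (fun v w => D_coef u z r0 s l v w <> 0)).
now apply continuity_2d_pt_neq_0; [apply (CD x y Ix)|].
Qed.

Lemma metric_smooth (I : R -> Prop) (u : R -> R) (z r0 : R) (s l : R -> R) (i j : idx) :
  open I -> smooth1 I u -> jet_equations I u z s l ->
  smooth2 (nondegenerate I u z r0 s l) (g_low (schrodinger_metric u z r0 s l) i j).
Proof.
intros oI su J n; assert (oU := nondegenerate_open I u z r0 s l oI su J).
destruct (EFD_C_on I u z r0 s l n oI su J) as (CE & CF & CD).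
destruct (jet_equations_C_on I u z s l n oI su J) as (_ & (Cl & _)).
set (U := nondegenerate I u z r0 s l) in *.
assert (Cm : forall h, C_on n (fun p => I (fst p)) h -> C_on n U
   (fun x y => lambda_coef u z r0 s l x y * h x y)).
{ intros h Ch; apply C_on_mult; trivial; [|now intros x y [Ix _]; apply Ch].
  apply C_on_inv; trivial.
  - intros x y [_ Dxy]; now apply pow_nonzero.
  - apply C_on_ext with (fun x y => D_coef u z r0 s l x y * D_coef u z r0 s l x y); trivial.
    + intros; ring.
    + apply C_on_mult; trivial; now intros x y [Ix _]; apply CD. }
destruct i, j; simpl; now apply Cm.
Qed.

(** * Derivatives of E, F and D *)

Definition Dx_coef (u : R -> R) (z r0 : R) (s l : R -> R) (x y : R) : R :=
  2 * F_coef s l x y * (Derive s x - / 2 * y * Derive_n l 2 x)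
  - Derive l x * E_coef u z r0 s l x y + 2 * l x * (u x + z) * y * F_coef s l x y.

Definition Ey_coef (u : R -> R) (z : R) (s l : R -> R) (x y : R) : R :=
  y * Derive_n l 2 x - 2 * Derive s x - 2 * y * l x * (u x + z).

Definition Dy_coef (u : R -> R) (z r0 : R) (s l : R -> R) (x y : R) : R :=
  - F_coef s l x y * Derive l x - l x * Ey_coef u z s l x y.

(** The mixed derivative of D, after the system for s and l has been used; so
    it is both the y-derivative of [Dx_coef], by mere computation, and the
    x-derivative of [Dy_coef], by the equations for s and l. *)
Definition Dxy_coef (u : R -> R) (z : R) (s l : R -> R) (x y : R) : R :=
  - (Derive s x - / 2 * y * Derive_n l 2 x) * Derive l x
  - F_coef s l x y * Derive_n l 2 x - Derive l x * Ey_coef u z s l x y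
  - 2 * l x * (u x + z) * (y * Derive l x - s x).

(* Derivatives of s and l are replaced by function variables, which keeps
   [auto_derive] from descending into [Derive].  It unfolds [Rinv], which has
   to be folded back for [field]. *)
Ltac derive_coef :=
  match goal with
  | H : jet_equations ?I ?u ?z ?s ?l, Ix : ?I ?x |- _ =>
    let du := fresh in let ds := fresh in let ds1 := fresh in
    let dl := fresh in let dl1 := fresh in let dl2 := fresh in
    destruct (H x Ix) as (du & ds & ds1 & dl & dl1 & dl2);
    rewrite /Dxy_coef /Dx_coef /Dy_coef /Ey_coef /D_coef /E_coef /F_coef;
    set (s1 := Derive s) in *; set (l1 := Derive l) in *;
    set (l2 := Derive_n l 2) in *; set (u1 := Derive u x) in *;
    clearbody s1 l1 l2 u1;
    auto_derive;
    [ repeat split; eexists; eassumption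
    | repeat match goal with
             | K : is_derive ?f x ?d |- context [Derive (fun t => ?f t) x] =>
               rewrite (is_derive_unique f x d K)
             end;
      change RinvImpl.Rinv with Rinv; field ]
  end.

Ltac derive_coef_y s l x :=
  generalize (Derive s x) (Derive l x) (Derive_n l 2 x);
  intros; auto_derive; trivial; change RinvImpl.Rinv with Rinv; field.

(** The first of Liouville's equations, E_x = - 2 q y F.  It uses the equations
    for s and l: they turn s'' and l''' into lower-order terms, and u'
    cancels. *)
Lemma E_coef_x (I : R -> Prop) (u : R -> R) (z r0 : R) (s l : R -> R) (x y : R) :
  jet_equations I u z s l -> I x ->
  is_derive (fun t => E_coef u z r0 s l t y) x (- 2 * (u x + z) * y * F_coef s l x y).
Proof. intros J Ix; derive_coef. Qed.

Lemma E_coef_y (u : R -> R) (z r0 : R) (s l : R -> R) (x y : R) :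
  is_derive (fun t => E_coef u z r0 s l x t) y (Ey_coef u z s l x y).
Proof. unfold E_coef, Ey_coef; derive_coef_y s l x. Qed.

Lemma F_coef_x (I : R -> Prop) (u : R -> R) (z : R) (s l : R -> R) (x y : R) :
  jet_equations I u z s l -> I x ->
  is_derive (fun t => F_coef s l t y) x (Derive s x - / 2 * y * Derive_n l 2 x).
Proof. intros J Ix; derive_coef. Qed.

Lemma F_coef_y (s l : R -> R) (x y : R) :
  is_derive (fun t => F_coef s l x t) y (- / 2 * Derive l x).
Proof. unfold F_coef; derive_coef_y s l x. Qed.

Lemma D_coef_x (I : R -> Prop) (u : R -> R) (z r0 : R) (s l : R -> R) (x y : R) :
  jet_equations I u z s l -> I x ->
  is_derive (fun t => D_coef u z r0 s l t y) x (Dx_coef u z r0 s l x y).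
Proof. intros J Ix; derive_coef. Qed.

Lemma D_coef_y (u : R -> R) (z r0 : R) (s l : R -> R) (x y : R) :
  is_derive (fun t => D_coef u z r0 s l x t) y (Dy_coef u z r0 s l x y).
Proof.
unfold D_coef, Dy_coef, Ey_coef, F_coef, E_coef; derive_coef_y s l x.
Qed.

Lemma Dy_coef_y (u : R -> R) (z r0 : R) (s l : R -> R) (x y : R) :
  is_derive (fun t => Dy_coef u z r0 s l x t) y
   (/ 2 * Derive l x ^ 2 - l x * (Derive_n l 2 x - 2 * l x * (u x + z))).
Proof. unfold Dy_coef, Ey_coef, F_coef; derive_coef_y s l x. Qed.

Lemma Dy_coef_x (I : R -> Prop) (u : R -> R) (z r0 : R) (s l : R -> R) (x y : R) :
  jet_equations I u z s l -> I x ->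
  is_derive (fun t => Dy_coef u z r0 s l t y) x (Dxy_coef u z s l x y).
Proof. intros J Ix; derive_coef. Qed.

(** * Christoffel symbols and curvature *)

Lemma is_derive_conformal (h d : R -> R) (x dh dd : R) :
  d x <> 0 -> is_derive h x dh -> is_derive d x dd ->
  is_derive (fun t => / (d t ^ 2) * h t) x (dh / d x ^ 2 - 2 * h x * dd / d x ^ 3).
Proof.
intros d0 Hh Hd; auto_derive.
- refine (conj _ (conj _ (conj _ I))); [now exists dd | | now exists dh].
  now apply Rmult_integral_contrapositive; split; [|rewrite Rmult_1_r].
- rewrite (is_derive_unique _ _ _ Hh) (is_derive_unique _ _ _ Hd).
  now change RinvImpl.Rinv with Rinv; field.
Qed.

(** In this order for E, F, l and D; the entries of the first three satisfy
    Liouville's equations. *)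
Definition EFlD_pd (u : R -> R) (z r0 : R) (s l : R -> R) (i : idx) (x y : R)
  : R * R * R * R :=
  match i with
  | i1 => (- 2 * (u x + z) * y * F_coef s l x y,
           Derive s x - / 2 * y * Derive_n l 2 x, Derive l x, Dx_coef u z r0 s l x y)
  | i2 => (Ey_coef u z s l x y, - / 2 * Derive l x, 0, Dy_coef u z r0 s l x y)
  end.

Lemma metric_pd (I : R -> Prop) (u : R -> R) (z r0 : R) (s l : R -> R) (i : idx) (x y : R) :
  jet_equations I u z s l -> nondegenerate I u z r0 s l (x, y) ->
  let g := schrodinger_metric u z r0 s l in
  let D := D_coef u z r0 s l x y in
  let '(dE, dF, dl, dD) := EFlD_pd u z r0 s l i x y in
  pd i (g11 g) x y = dE / D ^ 2 - 2 * E_coef u z r0 s l x y * dD / D ^ 3 /\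
  pd i (g12 g) x y = dF / D ^ 2 - 2 * F_coef s l x y * dD / D ^ 3 /\
  pd i (g22 g) x y = dl / D ^ 2 - 2 * l x * dD / D ^ 3.
Proof.
intros J [Ix D0]; simpl in Ix, D0.
assert (Dx := D_coef_x I u z r0 s l x y J Ix); assert (Dy := D_coef_y u z r0 s l x y).
assert (dl : is_derive l x (Derive l x)) by apply (J x Ix).
destruct i; refine (conj _ (conj _ _)); apply is_derive_unique.
- exact (is_derive_conformal _ (fun t => D_coef u z r0 s l t y) x _ _ D0
    (E_coef_x I u z r0 s l x y J Ix) Dx).
- exact (is_derive_conformal _ (fun t => D_coef u z r0 s l t y) x _ _ D0
    (F_coef_x I u z s l x y J Ix) Dx).
- exact (is_derive_conformal _ (fun t => D_coef u z r0 s l t y) x _ _ D0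
    dl Dx).
- exact (is_derive_conformal _ (fun t => D_coef u z r0 s l x t) y _ _ D0
    (E_coef_y u z r0 s l x y) Dy).
- exact (is_derive_conformal _ (fun t => D_coef u z r0 s l x t) y _ _ D0
    (F_coef_y s l x y) Dy).
- exact (is_derive_conformal (fun _ => l x) (fun t => D_coef u z r0 s l x t) y _ _ D0
    (is_derive_const (l x) y) Dy).
Qed.

Lemma metric_det (u : R -> R) (z r0 : R) (s l : R -> R) (x y : R) :
  D_coef u z r0 s l x y <> 0 ->
  g_det (schrodinger_metric u z r0 s l) x y = - / D_coef u z r0 s l x y ^ 3.
Proof.
intros D0.
assert (eD : D_coef u z r0 s l x y =
  F_coef s l x y ^ 2 - l x * E_coef u z r0 s l x y) by reflexivity.
unfold g_det; simpl; unfold lambda_coef; rewrite -> eD in *; now field.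
Qed.

(** The projective change with psi_j = - D_j / (2 D) of the connection whose
    only nonzero coefficient is Gamma^2_11 = - q y. *)
Definition schrodinger_christoffel (u : R -> R) (z r0 : R) (s l : R -> R) (k i j : idx)
    (x y : R) : R :=
  let D := D_coef u z r0 s l x y in
  match k, i, j with
  | i1, i1, i1 => - Dx_coef u z r0 s l x y / D
  | i1, i2, i2 => 0
  | i1, _, _ => - Dy_coef u z r0 s l x y / (2 * D)
  | i2, i1, i1 => - (u x + z) * y
  | i2, i2, i2 => - Dy_coef u z r0 s l x y / D
  | i2, _, _ => - Dx_coef u z r0 s l x y / (2 * D)
  end.

(** The Christoffel symbols are polynomials in 1/D, E, F, l and first
    derivatives.  Once these derivatives are eliminated by Liouville's
    equations, the claim is an identity in E, F, l, l', F_x and q y, with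
    D = F^2 - l E. *)
Lemma christoffelE (I : R -> Prop) (u : R -> R) (z r0 : R) (s l : R -> R)
    (k i j : idx) (x y : R) :
  jet_equations I u z s l -> nondegenerate I u z r0 s l (x, y) ->
  christoffel (schrodinger_metric u z r0 s l) k i j x y =
  schrodinger_christoffel u z r0 s l k i j x y.
Proof.
intros J U; assert (Px := metric_pd I u z r0 s l i1 x y J U).
assert (Py := metric_pd I u z r0 s l i2 x y J U).
destruct U as [_ D0]; simpl in D0; unfold EFlD_pd in Px, Py; cbv zeta in Px, Py.
destruct Px as (p11 & p12 & p22), Py as (q11 & q12 & q22).
assert (eD : D_coef u z r0 s l x y =
  F_coef s l x y ^ 2 - l x * E_coef u z r0 s l x y) by reflexivity.
assert (ex : Dx_coef u z r0 s l x y =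
  2 * F_coef s l x y * (Derive s x - / 2 * y * Derive_n l 2 x)
  - Derive l x * E_coef u z r0 s l x y + 2 * l x * (u x + z) * y * F_coef s l x y)
  by reflexivity.
assert (ey : Dy_coef u z r0 s l x y =
  - F_coef s l x y * Derive l x - l x * Ey_coef u z s l x y)
  by reflexivity.
(* E_y + 2 F_x = - 2 q y l *)
assert (eE : Ey_coef u z s l x y = 2 * y * l x * - (u x + z)
   - 2 * (Derive s x - / 2 * y * Derive_n l 2 x)) by (unfold Ey_coef; field).
destruct k, i, j; unfold christoffel, sum_idx, g_up, g_low;
  rewrite metric_det //; rewrite ?p11 ?p12 ?p22 ?q11 ?q12 ?q22;
  simpl g11; simpl g12; simpl g22; unfold lambda_coef, schrodinger_christoffel;
  rewrite ex ey eE; rewrite -> eD in *;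
  clear - D0;
  generalize dependent (F_coef s l x y); intros F;
  generalize (E_coef u z r0 s l x y); intros E D0; field; auto.
Qed.

Lemma Dx_coef_y (u : R -> R) (z r0 : R) (s l : R -> R) (x y : R) :
  is_derive (fun t => Dx_coef u z r0 s l x t) y (Dxy_coef u z s l x y).
Proof.
unfold Dx_coef, Dxy_coef, Ey_coef, E_coef, F_coef; derive_coef_y s l x.
Qed.

Lemma christoffel_pd (I : R -> Prop) (u : R -> R) (z r0 : R) (s l : R -> R)
    (a k i j : idx) (x y : R) :
  open I -> smooth1 I u -> jet_equations I u z s l -> nondegenerate I u z r0 s l (x, y) ->
  pd a (christoffel (schrodinger_metric u z r0 s l) k i j) x y =
  pd a (schrodinger_christoffel u z r0 s l k i j) x y.
Proof.
intros oI su J U.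
assert (near := open_locally_2d _ _ _ (nondegenerate_open I u z r0 s l oI su J) U).
destruct a; apply Derive_ext_loc.
- generalize (locally_2d_1d_const_y _ _ _ near); apply filter_imp; intros t Ut.
  now apply (christoffelE I).
- generalize (locally_2d_1d_const_x _ _ _ near); apply filter_imp; intros t Ut.
  now apply (christoffelE I).
Qed.

Lemma Derive_quotient (h d : R -> R) (x dh dd : R) :
  d x <> 0 -> is_derive h x dh -> is_derive d x dd ->
  Derive (fun t => - h t / d t) x = h x * dd / d x ^ 2 - dh / d x.
Proof.
intros d0 Hh Hd; apply is_derive_unique; auto_derive.
- refine (conj _ (conj _ (conj d0 I))); [now exists dh | now exists dd].
- rewrite (is_derive_unique _ _ _ Hh) (is_derive_unique _ _ _ Hd).
  now change RinvImpl.Rinv with Rinv; field.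
Qed.

Lemma Derive_quotient_half (h d : R -> R) (x dh dd : R) :
  d x <> 0 -> is_derive h x dh -> is_derive d x dd ->
  Derive (fun t => - h t / (2 * d t)) x = / 2 * (h x * dd / d x ^ 2 - dh / d x).
Proof.
intros d0 Hh Hd; rewrite -(Derive_quotient h d x dh dd) // -Derive_scal.
apply Derive_ext; intros t; unfold Rdiv; rewrite Rinv_mult; ring.
Qed.

(** R_1212 involves only the derivatives of Gamma^1_22, Gamma^1_12,
    Gamma^2_22 and Gamma^2_12, so the second derivatives D_xy and D_yy of D,
    not D_xx, occur. *)
Lemma gauss_curvature_schrodinger (I : R -> Prop) (u : R -> R) (z r0 : R) (s l : R -> R)
    (x y : R) :
  open I -> smooth1 I u -> jet_equations I u z s l -> nondegenerate I u z r0 s l (x, y) ->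
  4 * gauss_curvature (schrodinger_metric u z r0 s l) x y =
        2 * (r0 * l x - s x ^ 2) * Derive_n l 2 x
        - r0 * Derive l x ^ 2
        + 4 * s x * Derive l x * Derive s x
        - 4 * l x * Derive s x ^ 2
        + 4 * l x * (s x ^ 2 - r0 * l x) * (u x + z).
Proof.
intros oI su J U; pose proof U as [Ix D0]; simpl in Ix, D0.
assert (Dx := D_coef_x I u z r0 s l x y J Ix); assert (Dy := D_coef_y u z r0 s l x y).
assert (Dyx := Dy_coef_x I u z r0 s l x y J Ix); assert (Dyy := Dy_coef_y u z r0 s l x y).
assert (Dxy := Dx_coef_y u z r0 s l x y).
assert (e11 := Derive_const 0 x).
assert (e12 := Derive_quotient_half (fun t => Dy_coef u z r0 s l x t)
  (fun t => D_coef u z r0 s l x t) y _ _ D0 Dyy Dy).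
assert (e21 := Derive_quotient (fun t => Dy_coef u z r0 s l t y)
  (fun t => D_coef u z r0 s l t y) x _ _ D0 Dyx Dx).
assert (e22 := Derive_quotient_half (fun t => Dx_coef u z r0 s l x t)
  (fun t => D_coef u z r0 s l x t) y _ _ D0 Dxy Dy).
cbv beta in e12, e21, e22.
unfold gauss_curvature, riemann_low, riemann_up, sum_idx.
rewrite metric_det //; rewrite !(christoffel_pd I) //; rewrite !(christoffelE I) //.
unfold pd, schrodinger_christoffel, g_low; cbv zeta.
rewrite e11 e12 e21 e22; simpl g11; simpl g12; unfold lambda_coef.
clear - D0; revert D0.
unfold Dxy_coef, Dx_coef, Dy_coef, Ey_coef.
assert (eD : D_coef u z r0 s l x y =
  F_coef s l x y ^ 2 - l x * E_coef u z r0 s l x y) by reflexivity.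
rewrite eD; unfold E_coef, F_coef; intros D0; field.
intros H; apply D0; lra.
Qed.

(** * Series of functions dominated by a geometric series *)

Lemma ex_series_half (C : R) : ex_series (fun n => C * (/ 2) ^ n).
Proof.
apply (ex_series_scal C (fun n => (/ 2) ^ n)), ex_series_geom.
rewrite Rabs_pos_eq; lra.
Qed.

Lemma ex_series_half_bounded (a : nat -> R) (C : R) :
  (forall n, Rabs (a n) <= C * (/ 2) ^ n) -> ex_series a.
Proof. intros H; apply (ex_series_le a _ H), ex_series_half. Qed.

Lemma Series_half_bound (a : nat -> R) (C : R) :
  (forall n, Rabs (a n) <= C * (/ 2) ^ n) -> Rabs (Series a) <= 2 * C.
Proof.
intros H.
assert (e : Series (fun n => C * (/ 2) ^ n) = 2 * C).
{ rewrite Series_scal_l Series_geom; [field | rewrite Rabs_pos_eq; lra]. }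
rewrite -e; apply Rle_trans with (Series (fun n => Rabs (a n))).
- apply Series_Rabs, (ex_series_half_bounded _ C); intros n; now rewrite Rabs_Rabsolu.
- apply Series_le; [|apply ex_series_half].
  intros n; split; [apply Rabs_pos | apply H].
Qed.

(** The M-test for the majorant C / 2^n: the tail after N is at most C / 2^N. *)
Lemma CVU_half (fn : nat -> R -> R) (C c : R) (r : posreal) :
  (forall n y, Boule c r y -> Rabs (fn n y) <= C * (/ 2) ^ n) ->
  CVU (fun N y => sum_f_R0 (fun n => fn n y) N) (fun y => Series (fun n => fn n y)) c r.
Proof.
intros H eps he.
destruct (pow_lt_1_zero (/ 2) ltac:(rewrite Rabs_pos_eq; lra) (eps / (Rabs C + 1)))
  as [N HN].
{ apply Rdiv_lt_0_compat; trivial; generalize (Rabs_pos C); lra. }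
exists N; intros n y hn By.
assert (ex : ex_series (fun k => fn k y)).
{ apply (ex_series_half_bounded _ C); intros k; now apply H. }
rewrite (Series_incr_n (fun k => fn k y) (S n) (Nat.lt_0_succ n) ex).
replace (_ + _ - _) with (Series (fun k => fn (S n + k)%nat y)) by (simpl; ring).
apply Rle_lt_trans with (2 * (C * (/ 2) ^ S n)).
- apply Series_half_bound; intros k.
  rewrite Rmult_assoc -pow_add; now apply H.
- specialize (HN n hn); rewrite Rabs_pos_eq in HN; [|apply pow_le; lra].
  apply Rle_lt_trans with ((Rabs C + 1) * (/ 2) ^ n).
  + simpl; assert (0 <= (/ 2) ^ n) by (apply pow_le; lra).
    generalize (Rle_abs C); nra.
  + apply (Rmult_lt_compat_l (Rabs C + 1)) in HN; [|generalize (Rabs_pos C); lra].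
    replace ((Rabs C + 1) * (eps / (Rabs C + 1))) with eps in HN; trivial.
    field; generalize (Rabs_pos C); lra.
Qed.

(** Termwise differentiation needs uniform convergence of the differentiated
    series and continuity of its sum; the M-test gives both. *)
Lemma is_derive_Series_half (fn fn' : nat -> R -> R) (C c : R) (r : posreal) :
  (forall n y, Boule c r y -> is_derive (fn n) y (fn' n y)) ->
  (forall n y, Boule c r y -> continuous (fn' n) y) ->
  (forall n y, Boule c r y -> Rabs (fn n y) <= C * (/ 2) ^ n) ->
  (forall n y, Boule c r y -> Rabs (fn' n y) <= C * (/ 2) ^ n) ->
  forall y, Boule c r y ->
  is_derive (fun x => Series (fun n => fn n x)) y (Series (fun n => fn' n y)).
Proof.
intros d c' b b' y By; apply is_derive_Reals.
assert (cv' := CVU_half fn' C c r b').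
apply (Ranalysis5.derivable_pt_lim_CVU
  (fun N x => sum_f_R0 (fun n => fn n x) N) (fun N x => sum_f_R0 (fun n => fn' n x) N)
  _ (fun x => Series (fun n => fn' n x)) y c r); trivial.
- intros x N Bx; apply is_derive_Reals.
  induction N as [|N IH]; [now apply d|].
  apply (is_derive_plus (fun x => sum_f_R0 (fun n => fn n x) N) (fn (S N))); trivial.
  now apply d.
- intros x Bx; apply is_lim_seq_Reals.
  apply is_lim_seq_ext with (sum_n (fun n => fn n x)); [intros; apply sum_n_Reals|].
  apply Series_correct, (ex_series_half_bounded _ C); intros n; now apply b.
- intros x Bx; apply (CVU_continuity _ _ c r cv'); trivial.
  intros N v Bv; apply continuity_pt_filterlim.
  induction N as [|N IH]; [now apply c'|].
  apply (continuous_plus (fun x => sum_f_R0 (fun n => fn' n x) N) (fn' (S N))); trivial.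
  now apply c'.
Qed.

(** * Local solutions of s'' = q s *)

Lemma RInt_bound (f : R -> R) (x0 x M h : R) :
  (forall t, continuous f t) -> Rabs (x - x0) <= h ->
  (forall t, Rabs (t - x0) <= h -> Rabs (f t) <= M) ->
  Rabs (RInt f x0 x) <= h * M.
Proof.
intros cf hx bf.
assert (M0 : 0 <= M).
{ apply Rle_trans with (Rabs (f x)); [apply Rabs_pos | now apply bf]. }
assert (ex : forall p q, ex_RInt f p q)
  by (intros; apply: ex_RInt_continuous; intros; apply cf).
apply Rle_trans with (Rabs (x - x0) * M); [|now apply Rmult_le_compat_r].
destruct (Rle_dec x0 x) as [le|gt].
- rewrite (Rabs_pos_eq (x - x0)); [|lra].
  apply abs_RInt_le_const; trivial; intros t ht; apply bf.
  revert hx; rewrite !Rabs_pos_eq; lra.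
- rewrite -(opp_RInt_swap f x x0) // Rabs_Ropp (Rabs_left1 (x - x0)); [|lra].
  replace (- (x - x0)) with (x0 - x) by ring.
  apply abs_RInt_le_const; trivial; [lra|]; intros t ht; apply bf.
  revert hx; rewrite !Rabs_left1; lra.
Qed.

Lemma is_derive_RInt_continuous (f : R -> R) (x0 x : R) :
  (forall t, continuous f t) -> is_derive (fun y => RInt f x0 y) x (f x).
Proof.
intros cf; apply (is_derive_RInt f _ x0); [|apply cf].
apply filter_forall; intros y; apply: RInt_correct.
apply: ex_RInt_continuous; intros; apply cf.
Qed.

(** The terms, not the partial sums, of Picard's iteration for s'' = q s,
    s(x0) = 1, s'(x0) = 0; [picard'] and [picard''] are their derivatives. *)
Fixpoint picard (q : R -> R) (x0 : R) (n : nat) : R -> R :=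
  match n with
  | O => fun _ => 1
  | S m => fun x => RInt (fun t => RInt (fun v => q v * picard q x0 m v) x0 t) x0 x
  end.

Definition picard' (q : R -> R) (x0 : R) (n : nat) : R -> R :=
  match n with
  | O => fun _ => 0
  | S m => fun t => RInt (fun v => q v * picard q x0 m v) x0 t
  end.

Definition picard'' (q : R -> R) (x0 : R) (n : nat) : R -> R :=
  match n with
  | O => fun _ => 0
  | S m => fun v => q v * picard q x0 m v
  end.

Lemma picard_facts (q : R -> R) (x0 : R) (n : nat) :
  (forall t, continuous q t) ->
  forall t, continuous (picard'' q x0 n) t /\
    is_derive (picard' q x0 n) t (picard'' q x0 n t) /\
    is_derive (picard q x0 n) t (picard' q x0 n t).
Proof.
intros cq; induction n as [|n IH]; intros t.
- refine (conj _ (conj _ _)); [apply continuous_const | apply @is_derive_const ..].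
- assert (c'' : forall t, continuous (fun v => q v * picard q x0 n v) t).
  { intros v; apply (continuous_mult q); [apply cq|].
    apply: ex_derive_continuous; exists (picard' q x0 n v); apply IH. }
  assert (d' : forall t, is_derive (picard' q x0 (S n)) t (picard'' q x0 (S n) t)).
  { intros v; now apply is_derive_RInt_continuous. }
  refine (conj (c'' t) (conj (d' t) _)).
  apply is_derive_RInt_continuous; intros v.
  apply: ex_derive_continuous; eexists; apply d'.
Qed.

(** Each step integrates q times the previous term twice over a length at
    most h, and h M <= 1/2, h <= 1: it gains a factor 1/2 in both the term and
    its derivative. *)
Lemma picard_bounds (q : R -> R) (x0 h M : R) (n : nat) :
  (forall t, continuous q t) -> (forall t, Rabs (q t) <= M) ->
  0 < h <= 1 -> h * M <= / 2 ->
  forall t, Rabs (t - x0) <= h ->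
    Rabs (picard q x0 n t) <= (/ 2) ^ n /\ Rabs (picard' q x0 n t) <= (/ 2) ^ n.
Proof.
intros cq bq h1 hM.
assert (M0 : 0 <= M) by (apply Rle_trans with (Rabs (q 0)); [apply Rabs_pos | apply bq]).
induction n as [|n IH]; intros t ht.
- simpl; rewrite Rabs_R1 Rabs_R0; lra.
- assert (p0 : 0 <= (/ 2) ^ n) by (apply pow_le; lra).
  assert (b' : forall t, Rabs (t - x0) <= h -> Rabs (picard' q x0 (S n) t) <= (/ 2) ^ S n).
  { intros v hv; apply Rle_trans with (h * (M * (/ 2) ^ n)); [|simpl; nra].
    apply RInt_bound; trivial.
    - intros w; apply (picard_facts q x0 (S n) cq w).
    - intros w hw; rewrite Rabs_mult; apply Rmult_le_compat; try apply Rabs_pos;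
        [apply bq | now apply IH]. }
  split; [|now apply b'].
  apply Rle_trans with (h * (/ 2) ^ S n); [|simpl; nra].
  apply RInt_bound; trivial; intros w.
  destruct (picard_facts q x0 (S n) cq w) as (_ & d & _).
  apply (ex_derive_continuous (picard' q x0 (S n))); now exists (picard'' q x0 (S n) w).
Qed.

(** Summing the terms; the series of second derivatives is, up to the shift
    of index, q times the series itself. *)
Lemma linear_ode_bounded (q : R -> R) (x0 M : R) (h : posreal) :
  (forall t, continuous q t) -> (forall t, Rabs (q t) <= M) ->
  h <= 1 -> h * M <= / 2 ->
  exists s s1 : R -> R, s x0 = 1 /\
    forall x, Boule x0 h x -> is_derive s x (s1 x) /\ is_derive s1 x (q x * s x).
Proof.
intros cq bq h1 hM.
assert (M0 : 0 <= M) by (apply Rle_trans with (Rabs (q 0)); [apply Rabs_pos | apply bq]).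
assert (b : forall n t, Boule x0 h t -> Rabs (picard q x0 n t) <= (/ 2) ^ n /\
  Rabs (picard' q x0 n t) <= (/ 2) ^ n).
{ intros n t Bt; apply picard_bounds with h M; trivial.
  - generalize (cond_pos h); lra.
  - unfold Boule in Bt; lra. }
exists (fun x => Series (fun n => picard q x0 n x)).
exists (fun x => Series (fun n => picard' q x0 n x)).
split.
- rewrite Series_incr_1.
  + rewrite (Series_ext _ (fun n => 0 * (/ 2) ^ n)).
    * rewrite Series_scal_l; simpl; ring.
    * intros n; simpl; rewrite RInt_point; unfold zero; simpl; ring.
  + apply (ex_series_half_bounded _ 1); intros n; rewrite Rmult_1_l; apply b.
    unfold Boule; rewrite Rminus_diag Rabs_R0; apply cond_pos.
- intros x Bx; split.
  + apply (is_derive_Series_half _ _ 1 x0 h); trivial;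
      try (intros n y By; rewrite Rmult_1_l; now apply b).
    * intros n y _; now apply picard_facts.
    * intros n y _; destruct (picard_facts q x0 n cq y) as (_ & d & _).
      apply: ex_derive_continuous; now exists (picard'' q x0 n y).
  + assert (b'' : forall n t, Boule x0 h t ->
      Rabs (picard'' q x0 n t) <= (2 * M + 1) * (/ 2) ^ n).
    { intros n t Bt; destruct n as [|n].
      - simpl; rewrite Rabs_R0; lra.
      - assert (p0 : 0 <= (/ 2) ^ n) by (apply pow_le; lra).
        apply Rle_trans with (M * (/ 2) ^ n); [|simpl; nra].
        simpl; rewrite Rabs_mult; apply Rmult_le_compat; try apply Rabs_pos;
          [apply bq | now apply b]. }
    replace (q x * _) with (Series (fun n => picard'' q x0 n x)).
    * apply (is_derive_Series_half _ _ (2 * M + 1) x0 h); trivial.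
      -- intros n y _; now apply picard_facts.
      -- intros n y _; now apply picard_facts.
      -- intros n y By; assert (p0 : 0 <= (/ 2) ^ n) by (apply pow_le; lra).
         apply Rle_trans with ((/ 2) ^ n); [now apply b | nra].
    * rewrite Series_incr_1;
        [|apply (ex_series_half_bounded _ (2 * M + 1)); intros n; now apply b''].
      simpl; now rewrite Rplus_0_l Series_scal_l.
Qed.

(** Continuity at x0 bounds q near x0; composing q with the retraction of R
    onto a small interval makes it bounded and continuous everywhere without
    changing it near x0. *)
Lemma linear_ode_local (q : R -> R) (I : R -> Prop) (x0 : R) :
  open I -> I x0 -> (forall x, I x -> continuous q x) ->
  exists (h : posreal) (s s1 : R -> R), s x0 = 1 /\
    forall x, Boule x0 h x ->
      I x /\ is_derive s x (s1 x) /\ is_derive s1 x (q x * s x).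
Proof.
intros oI Ix0 cq.
destruct (oI x0 Ix0) as [d1 hd1].
assert (cx0 : locally x0 (fun t => Rabs (q t - q x0) < 1)).
{ apply (cq x0 Ix0 (fun v => Rabs (v - q x0) < 1)); now exists (mkposreal 1 Rlt_0_1). }
destruct cx0 as [d2 hd2].
set (M := Rabs (q x0) + 1);
assert (M1 : 1 <= M) by (unfold M; generalize (Rabs_pos (q x0)); lra).
(* the factors 1/2 keep the closed interval of radius h inside both balls *)
set (h := Rmin (Rmin (d1 / 2) (d2 / 2)) (/ (2 * M))).
assert (hM : / (2 * M) * M = / 2) by (field; lra).
assert (hpos : 0 < h).
{ generalize (cond_pos d1) (cond_pos d2); intros; repeat apply Rmin_pos; try lra.
  apply Rinv_0_lt_compat; lra. }
assert (h1 : h <= d1 / 2) by (eapply Rle_trans; apply Rmin_l).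
assert (h2 : h <= d2 / 2) by (eapply Rle_trans; [apply Rmin_l | apply Rmin_r]).
assert (h3 : h <= / (2 * M)) by apply Rmin_r.
clearbody h.
(* the retraction of R onto [x0 - h, x0 + h], written with absolute values *)
set (c := fun t => x0 + / 2 * (Rabs (t - x0 + h) - Rabs (t - x0 - h))).
assert (cb : forall t, Rabs (c t - x0) <= h).
{ intros t; unfold c; apply Rabs_le; unfold Rabs; repeat destruct Rcase_abs; lra. }
assert (cid : forall t, Rabs (t - x0) < h -> c t = t).
{ intros t ht; apply Rabs_def2 in ht; unfold c.
  rewrite Rabs_pos_eq ?Rabs_left1; lra. }
assert (near : forall t, Rabs (t - x0) <= h -> I t /\ Rabs (q t) <= M).
{ intros t ht; split.
  - apply hd1; unfold ball; simpl; unfold AbsRing_ball, abs, minus, plus, opp; simpl.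
    generalize (cond_pos d1); unfold Rminus in ht; lra.
  - assert (b : Rabs (q t - q x0) < 1).
    { apply hd2; unfold ball; simpl; unfold AbsRing_ball, abs, minus, plus, opp; simpl.
      generalize (cond_pos d2); unfold Rminus in ht; lra. }
    unfold M; generalize (Rabs_triang (q t - q x0) (q x0)).
    replace (q t - q x0 + q x0) with (q t) by ring; lra. }
destruct (linear_ode_bounded (fun t => q (c t)) x0 M (mkposreal h hpos))
  as (s & s1 & s0 & ds).
- intros t; apply (continuous_comp c q); [|now apply cq, near].
  apply (continuous_plus (fun _ => x0)); [apply continuous_const|].
  apply (continuous_mult (fun _ => / 2)); [apply continuous_const|].
  apply (continuous_minus (fun t => Rabs (t - x0 + h)) (fun t => Rabs (t - x0 - h)));
    apply continuous_Rabs_comp; apply: ex_derive_continuous; now auto_derive.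
- intros t; now apply near.
- simpl; apply Rle_trans with (/ (2 * M)); trivial.
  rewrite -Rinv_1; apply Rinv_le_contravar; lra.
- simpl; rewrite -hM; apply Rmult_le_compat_r; lra.
- exists (mkposreal h hpos), s, s1; split; trivial.
  intros x Bx; unfold Boule in Bx; simpl in Bx.
  destruct (ds x Bx) as [d d']; rewrite cid in d'; trivial.
  refine (conj _ (conj d d')); apply near; lra.
Qed.

(** * Metrisability and the theorem *)

Lemma schrodinger_metric_metrises (I : R -> Prop) (u : R -> R) (z r0 : R) (s l : R -> R) :
  open I -> smooth1 I u -> jet_equations I u z s l ->
  metrises (nondegenerate I u z r0 s l) (schrodinger_metric u z r0 s l) (schrodinger u z).
Proof.
intros oI su J; split.
- refine (conj (nondegenerate_open I u z r0 s l oI su J) (conj _ _)).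
  + now intros i j; apply metric_smooth.
  + intros x y [_ D0]; rewrite metric_det //.
    now apply Ropp_neq_0_compat, Rinv_neq_0_compat, pow_nonzero.
- intros x y U; assert (D0 := proj2 U); simpl in D0.
  rewrite !(christoffelE I) //; unfold schrodinger_christoffel; simpl.
  refine (conj _ (conj _ (conj _ _))); now field.
Qed.

Lemma jet_equations_local (I : R -> Prop) (u : R -> R) (z : R) (s s1 : R -> R) :
  open I -> smooth1 I u ->
  (forall x, I x -> is_derive s x (s1 x) /\ is_derive s1 x ((u x + z) * s x)) ->
  jet_equations I u z s (fun _ => 0).
Proof.
intros oI su ds x Ix.
assert (d0 : forall t, Derive (fun _ => 0) t = 0) by apply Derive_const.
assert (d0' : forall t, Derive_n (fun _ => 0) 2 t = 0).
{ intros t; now rewrite Derive_n_const. }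
refine (conj _ (conj _ (conj _ (conj _ (conj _ _))))).
- apply (n_times_derivable_is_derive 1 0 I u x (su 1%nat)); trivial; lia.
- apply Derive_correct; exists (s1 x); now apply ds.
- apply is_derive_ext_loc with s1; [|now apply ds].
  generalize (oI x Ix); apply filter_imp; intros t It.
  now symmetry; apply is_derive_unique, ds.
- rewrite d0; apply @is_derive_const.
- apply is_derive_ext with (fun _ => 0); [now intros t; rewrite d0|].
  rewrite d0'; apply @is_derive_const.
- apply is_derive_ext with (fun _ => 0); [now intros t; rewrite d0'|].
  rewrite d0 !Rmult_0_r Rplus_0_l; apply @is_derive_const.
Qed.

(** With l = 0 and r0 = 0 the discriminant D is s^2, so a local solution s with
    s(x0) = 1 gives a metric near (x0, 0). *)
Lemma schrodinger_metrisable (I : R -> Prop) (u : R -> R) (z x0 : R) :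
  open I -> smooth1 I u -> I x0 ->
  metrisable (fun p => I (fst p)) (schrodinger u z).
Proof.
intros oI su Ix0.
destruct (linear_ode_local (fun x => u x + z) I x0 oI Ix0) as (h & s & s1 & s0 & ds).
{ intros x Ix; apply (continuous_plus u); [|apply continuous_const].
  apply: ex_derive_continuous; exact (su 1%nat 1%nat x (le_n 1) Ix). }
set (J := fun x => Boule x0 h x).
assert (oJ : open J).
{ intros x Bx; assert (p : 0 < h - Rabs (x - x0)) by (unfold J, Boule in Bx; lra).
  exists (mkposreal _ p); intros t; unfold ball; simpl.
  unfold AbsRing_ball, abs, minus, plus, opp, J, Boule; simpl; intros ht.
  generalize (Rabs_triang (t + - x) (x - x0)).
  replace (t + - x + (x - x0)) with (t - x0) by ring; lra. }
assert (suJ : smooth1 J u).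
{ intros n k x kn Jx; apply (su n k x kn); now apply ds. }
assert (ej : jet_equations J u z s (fun _ => 0)).
{ apply jet_equations_local with s1; trivial; intros x Jx; now apply ds. }
exists (nondegenerate J u z 0 s (fun _ => 0)).
exists (schrodinger_metric u z 0 s (fun _ => 0)).
refine (conj _ (conj _ _)).
- exists (x0, 0); split; simpl.
  + unfold J, Boule; rewrite Rminus_diag Rabs_R0; apply cond_pos.
  + unfold D_coef, F_coef; rewrite s0 Derive_const.
    rewrite Rmult_0_r Rmult_0_l !Rminus_0_r pow1; apply R1_neq_R0.
- intros p [Jp _]; now apply ds.
- now apply schrodinger_metric_metrises.
Qed.

Lemma interval_oo_open (a b : Rbar) : open (interval_oo a b).
Proof. apply open_and; [apply open_Rbar_gt | apply open_Rbar_lt]. Qed.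

Lemma interval_oo_nonempty (a b : Rbar) : Rbar_lt a b -> exists x : R, interval_oo a b x.
Proof.
destruct a as [a | | ], b as [b | | ]; simpl; intros ab; try easy.
- exists ((a + b) / 2); split; simpl; lra.
- exists (a + 1); split; simpl; trivial; lra.
- exists (b - 1); split; simpl; trivial; lra.
- now exists 0.
Qed.

Theorem theorem1 (a b : Rbar) (u : R -> R) (z : R)
    (hab : Rbar_lt a b) (hu : smooth1 (interval_oo a b) u) :
  metrisable (fun p => interval_oo a b (fst p)) (schrodinger u z) /\
  forall (r0 : R) (s l : R -> R),
    n_times_derivable 2 (interval_oo a b) s ->
    n_times_derivable 3 (interval_oo a b) l ->
    (forall x : R, interval_oo a b x ->
       Derive_n s 2 x - u x * s x = z * s x) ->
    (forall x : R, interval_oo a b x ->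
       Derive_n l 3 x - 4 * (u x + z) * Derive l x - 2 * Derive u x * l x = 0) ->
    (exists x y : R, interval_oo a b x /\ D_coef u z r0 s l x y <> 0) ->
    metrises
      (fun p => interval_oo a b (fst p) /\ D_coef u z r0 s l (fst p) (snd p) <> 0)
      (schrodinger_metric u z r0 s l) (schrodinger u z) /\
    forall x y : R, interval_oo a b x -> D_coef u z r0 s l x y <> 0 ->
      4 * gauss_curvature (schrodinger_metric u z r0 s l) x y =
        2 * (r0 * l x - s x ^ 2) * Derive_n l 2 x
        - r0 * Derive l x ^ 2
        + 4 * s x * Derive l x * Derive s x
        - 4 * l x * Derive s x ^ 2
        + 4 * l x * (s x ^ 2 - r0 * l x) * (u x + z).
Proof.
assert (oI := interval_oo_open a b); split.
- destruct (interval_oo_nonempty a b hab) as [x0 Ix0].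
  now apply (schrodinger_metrisable _ u z x0).
- intros r0 s l ds dl es el _.
  assert (J := jet_equations_intro _ u z s l hu ds dl es el); split.
  + exact (schrodinger_metric_metrises _ u z r0 s l oI hu J).
  + intros x y Ix D0; now apply (gauss_curvature_schrodinger (interval_oo a b)).
Qed.
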